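(* For $n\ge 2$ let $\sigma(n)$ be the set of eigenvalues of the connected anti-regular graph $A_n$, let $\sigma=\bigcup_{n}\sigma(n)$, and let $\bar\sigma$ be the closure of $\sigma$ in $\mathbb{R}$. Then \[\bar\sigma=\left(-\infty,\tfrac{-1-\sqrt2}{2}\right]\cup\{0,-1\}\cup\left[\tfrac{-1+\sqrt2}{2},\infty\right).\]
   Context: A simple graph is anti-regular if exactly two of its vertices have the same degree. For each $n\ge2$, $A_n$ denotes the unique (up to isomorphism) connected anti-regular graph on $n$ vertices; equivalently the threshold graph with creation sequence $(0,1,0,1,\dots,0,1)$ ($n$ even) or $(0,0,1,0,1,\dots,0,1)$ ($n$ odd), where a $1$ means the new vertex is joined to all previous vertices and a $0$ means it is added isolated. Eigenvalues are those of the adjacency matrix. *)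

(* Defs.v *)
From HB Require Import structures.
From mathcomp Require Import all_boot all_order all_algebra.
From mathcomp Require Import all_classical all_reals all_analysis.
Set Implicit Arguments.
Unset Strict Implicit.
Unset Printing Implicit Defensive.
Import Order.TTheory GRing.Theory Num.Theory.
Import numFieldNormedType.Exports.
Local Open Scope classical_set_scope.
Local Open Scope ring_scope.

Definition simple_graph (T : finType) (e : rel T) : Prop :=
  symmetric e /\ irreflexive e.

Definition connected_graph (T : finType) (e : rel T) : Prop :=
  forall x y : T, connect e x y.

Definition degree (T : finType) (e : rel T) (x : T) : nat := #|e x|.

(* "Exactly two vertices have the same degree": there is one and only one
   unordered pair of distinct vertices with equal degrees. *)
Definition antiregular (T : finType) (e : rel T) : Prop :=
  exists u v : T,
    [/\ u != v, degree e u = degree e v &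
        forall x y : T, x != y -> degree e x = degree e y ->
          (x = u /\ y = v) \/ (x = v /\ y = u)].

Definition adjacency_mx (R : realType) (n : nat) (e : rel 'I_n) : 'M[R]_n :=
  \matrix_(i < n, j < n) (e i j)%:R.

(* A_n is only determined up to isomorphism, so sigma(n) collects the
   eigenvalues of every connected anti-regular graph with vertex set 'I_n;
   isomorphic graphs have the same eigenvalues. *)
Definition antiregular_spectrum (R : realType) (n : nat) : set R :=
  [set x : R | exists e : rel 'I_n,
     [/\ simple_graph e, connected_graph e, antiregular e &
         eigenvalue (adjacency_mx R e) x]].
Arguments antiregular_spectrum : clear implicits.

Definition all_antiregular_eigenvalues (R : realType) : set R :=
  \bigcup_(n in [set n : nat | (2 <= n)%N]) antiregular_spectrum R n.
Arguments all_antiregular_eigenvalues : clear implicits.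

(* Main.v *)
Require Import Defs.
From mathcomp Require Import all_boot all_order all_algebra.
From mathcomp Require Import all_classical all_reals all_analysis.
From mathcomp Require Import fingroup perm ring lra zify.
Import Order.TTheory GRing.Theory Num.Theory.
Import numFieldNormedType.Exports.
Local Open Scope classical_set_scope.
Local Open Scope ring_scope.

(* Listing the vertices by increasing degree, A_n is the graph on {0,..,n-1} in
   which distinct i and j are adjacent iff i + j >= n - 1, and differences of
   consecutive rows turn its eigenvalue equation into a three-term recurrence
   v_(j+1) + v_(j-1) = (2 - 1/s) v_j with s = x (x + 1), for the entries v_j of
   either half of the list.
   If s < 1/4 and s != 0 then |2 - 1/s| > 2, the solution grows from the ends
   of the list to the middle, and it cannot match the equations there.
   If s >= 1/4 then s = 1/(4 sin^2 phi), and for n = 2k + 2 the solution is made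
   of cosines of odd multiples of phi; x is an eigenvalue iff
   (x + 1) cos((2k+3) phi) = x cos((2k+1) phi).  On each branch x = x(phi), the
   difference of both sides changes sign between consecutive zeros of
   cos((2k+3) phi), and these zeros become dense as k grows. *)

(** * The structure of connected anti-regular graphs *)

(* The graph A_n, with its vertices listed by increasing degree. *)
Definition threshold (n : nat) : rel 'I_n :=
  fun i j => (i != j) && (n <= (i + j).+1)%N.

Lemma degree_sum (n : nat) (e : rel 'I_n) (i : 'I_n) :
  degree e i = (\sum_(j < n) e i j)%N.
Proof.
rewrite /degree -sum1_card big_mkcond; apply: eq_bigr => j _.
by rewrite unfold_in; case: (e i j).
Qed.

(** The indices j with i + j >= n - 1 are the i + 1 largest ones; i itself is among them, and has to
    be discarded, exactly when 2i + 1 >= n. *)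
Lemma degree_threshold (n : nat) (i : 'I_n) :
  degree (threshold n) i = (i + (i.*2.+1 < n))%N.
Proof.
rewrite degree_sum.
have H : (\sum_(j < n) (n <= (i + j).+1))%N = i.+1.
  rewrite (reindex_inj rev_ord_inj) /=.
  rewrite (eq_bigr (fun j : 'I_n => if (j < i.+1)%N then 1%N else 0%N)); last first.
    by move=> j _; case: ifP => h; have := ltn_ord j; have := ltn_ord i; lia.
  by rewrite -big_mkcond -(big_ord_widen n (fun=> 1%N)) // sum1_card card_ord.
move: H; rewrite (bigD1 i) //= => H.
rewrite (bigD1 i) //= /threshold eqxx add0n.
rewrite (eq_bigr (fun j : 'I_n => nat_of_bool (n <= (i + j).+1)%N)); first by lia.
by move=> j; rewrite eq_sym => ->.
Qed.

Lemma threshold_simple (n : nat) : simple_graph (threshold n).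
Proof.
split=> [i j|i]; last by rewrite /threshold eqxx.
by rewrite /threshold eq_sym addnC.
Qed.

Lemma threshold_connected (n : nat) : connected_graph (threshold n).
Proof.
case: n => [|n] x y; first by case: x.
have sym : connect_sym (threshold n.+1).
  by apply: sym_connect_sym; case: (threshold_simple n.+1).
suff H z : connect (threshold n.+1) z ord_max.
  by apply: (connect_trans (H x)); rewrite sym.
have [->|zn] := eqVneq z ord_max; first exact: connect0.
by apply: connect1; rewrite /threshold zn /= ltnS leq_addl.
Qed.

Lemma threshold_antiregular (n : nat) : (1 < n)%N -> antiregular (threshold n).
Proof.
move=> n1.
(* The witness is the last i with 2i + 1 < n. Past it the indicator in the degree drops to 0, which
   cancels the increase of i; everywhere else the degree grows strictly. *)
have mn : (n.-2./2 < n)%N by lia.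
have m1n : (n.-2./2.+1 < n)%N by lia.
exists (Ordinal mn), (Ordinal m1n); split.
- by apply/eqP => -[]; lia.
- by rewrite !degree_threshold /=; lia.
- move=> x y xy; rewrite !degree_threshold => d.
  have {}xy : nat_of_ord x != nat_of_ord y by [].
  have : (x = n.-2./2 :> nat /\ y = n.-2./2.+1 :> nat) \/
         (x = n.-2./2.+1 :> nat /\ y = n.-2./2 :> nat).
    by move: (ltn_ord x) (ltn_ord y) xy d; case: ltnP; case: ltnP; lia.
  by case=> -[hx hy]; [left|right]; split; apply: val_inj.
Qed.

(* [i + (i <= m)] lists the degrees of an anti-regular graph in increasing
   order.  With the weights w_i = 2i - (n-1), the sum of
   (deg_i - deg_i(threshold)) w_i is termwise nonnegative, whereas its
   symmetrization, the sum of (e_ij - threshold_ij) (w_i + w_j) / 2, is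
   termwise nonpositive. *)
Lemma graph_of_sorted_degrees (n m : nat) (e : rel 'I_n) :
  simple_graph e -> (forall i, degree e i = (i + (i <= m))%N) ->
  forall i j, e i j = threshold n i j.
Proof.
move=> [esym eirr] de.
pose w (i : 'I_n) : int := (2 * i)%:Z - n%:Z + 1.
pose D (i j : 'I_n) : int := (e i j)%:Z - (threshold n i j)%:Z.
have Dsym i j : D i j = D j i by rewrite /D esym (threshold_simple n).1.
have rowD i : \sum_j D i j = (i <= m)%N%:Z - (i.*2.+1 < n)%N%:Z.
  rewrite /D big_split /= sumrN.
  have -> : \sum_(j < n) (e i j)%:Z = (degree e i)%:Z.
    by rewrite degree_sum (big_morph Posz PoszD (erefl 0)).
  have -> : \sum_(j < n) (threshold n i j)%:Z = (degree (threshold n) i)%:Z.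
    by rewrite degree_sum (big_morph Posz PoszD (erefl 0)).
  rewrite de degree_threshold; lia.
have row_ge0 i : 0 <= (\sum_j D i j) * w i.
  by rewrite rowD /w; case: (leqP i m); case: ltnP; lia.
have D_le0 i j : D i j * (w i + w j) <= 0.
  rewrite /D /threshold /w; have [->|ij] := eqVneq i j; first by rewrite eirr; lia.
  by case: (e i j); case: leqP => /=; lia.
have sum2 : \sum_i (\sum_j D i j) * w i *+ 2 = \sum_i \sum_j D i j * (w i + w j).
  under [RHS]eq_bigr => i _.
    under eq_bigr do rewrite mulrDr.
    rewrite big_split /= -mulr_suml; over.
  rewrite !big_split /=; congr (_ + _).
  rewrite exchange_big /=; apply: eq_bigr => i _.
  by rewrite mulr_suml; apply: eq_bigr => j _; rewrite Dsym.
have sum_eq0 : \sum_i (\sum_j D i j) * w i *+ 2 = 0.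
  apply/le_anti/andP; split; last by apply: sumr_ge0 => i _; rewrite mulrn_wge0.
  by rewrite sum2; apply: sumr_le0 => i _; apply: sumr_le0.
have row_eq0 i : (\sum_j D i j) * w i = 0.
  have := psumr_eq0P (fun i' _ => mulrn_wge0 2 (row_ge0 i')) sum_eq0 (i := i) isT.
  by lia.
have D_eq0 i j : D i j * (w i + w j) = 0.
  have nD i' j' : 0 <= - (D i' j' * (w i' + w j')) by rewrite oppr_ge0.
  have S0 : \sum_i' \sum_j' - (D i' j' * (w i' + w j')) = 0.
    under eq_bigr do rewrite sumrN.
    by rewrite sumrN -sum2 sum_eq0 oppr0.
  have R0 := psumr_eq0P (fun i' _ => sumr_ge0 _ (fun j' _ => nD i' j')) S0 (i := i) isT.
  have /eqP := psumr_eq0P (fun j' _ => nD i j') R0 (i := j) isT.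
  by rewrite oppr_eq0 => /eqP.
move=> i j.
suff : D i j = 0 by rewrite /D; case: (e i j); case: (threshold n i j).
have [->|ij] := eqVneq i j; first by rewrite /D eirr (threshold_simple n).2.
(* The weights leave only j = n - 1 - i undecided. That entry is the only one remaining in row i,
   whose sum vanishes since w_i != 0. *)
have [wij|wij] := eqVneq (w i + w j) 0; last first.
  by have /eqP := D_eq0 i j; rewrite mulf_eq0 (negPf wij) orbF => /eqP.
have wi : w i != 0.
  apply/eqP => wi0; case/negP: ij; apply/eqP/val_inj; move: wij wi0; rewrite /w /=; lia.
have /eqP := row_eq0 i; rewrite mulf_eq0 (negPf wi) orbF => /eqP.
rewrite (bigD1 j) //= big1 ?addr0 // => k kj.
have /eqP := D_eq0 i k; rewrite mulf_eq0 => /orP[/eqP //|/eqP wik].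
case/negP: kj; apply/eqP/val_inj; move: wij wik; rewrite /w /=; lia.
Qed.

(** Connectedness puts all degrees in 1..n-1, and only [u] and [v] share one. Breaking this tie
    turns degrees into a bijective rank, and relabelling by rank leads to
    [graph_of_sorted_degrees]. *)
Lemma antiregular_threshold (n : nat) (e : rel 'I_n) :
  (1 < n)%N -> simple_graph e -> connected_graph e -> antiregular e ->
  exists f : {perm 'I_n}, forall i j, e i j = threshold n (f i) (f j).
Proof.
move=> n1 [esym eirr] econ [u [v [uv duv eqd]]].
have d_gt0 x : (0 < degree e x)%N.
  have [y xy] : exists y : 'I_n, y != x.
    by exists (if x == u then v else u); case: (eqVneq x u) => [->|]; rewrite eq_sym.
  case/connectP: (econ x y) => -[|z p] /= => [_ yx|/andP[exz _] _].
    by rewrite yx eqxx in xy.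
  by apply/card_gt0P; exists z.
have d_lt x : (degree e x < n)%N.
  rewrite -[X in (_ < X)%N](card_ord n); apply: proper_card.
  apply/properP; split; first exact: fintype.subset_predT.
  by exists x; rewrite // unfold_in eirr.
(* The low vertices are those ranked before [v]: smaller degree than [u], or [u] itself. Lowering
   their degree by one separates [u] from [v] and makes the ranks start at 0. *)
pose low x := (degree e x < degree e u)%N || (x == u).
pose r x := (degree e x - low x)%N.
have r_lt x : (r x < n)%N by have := d_lt x; rewrite /r; lia.
pose g x : 'I_n := Ordinal (r_lt x).
have low_le x : if low x then (degree e x <= degree e u)%N
                else (degree e u <= degree e x)%N.
  by rewrite /low; case: eqVneq => [->|_]; rewrite ?orbT // orbF; case: ltnP => [/ltnW|].
have g_inj : injective g.
  move=> x y /(congr1 val) /=; rewrite /r => rxy; apply/eqP/negPn/negP => xy.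
  have := low_le x; have := low_le y.
  have [lxy|lxy] := eqVneq (low x) (low y); last first.
    move: rxy lxy (d_gt0 x) (d_gt0 y); case: (low x); case: (low y) => //=; lia.
  have /(eqd x y xy) : degree e x = degree e y.
    by move: rxy (d_gt0 x) (d_gt0 y); rewrite lxy; case: (low y) => /=; lia.
  have lu : low u = true by rewrite /low eqxx orbT.
  have lv : low v = false by rewrite /low -duv ltnn eq_sym (negPf uv).
  by case=> -[xE yE]; move: lxy; rewrite xE yE lu lv.
pose f := perm g_inj.
have fE x : f x = r x :> nat by rewrite permE.
exists f => i j.
have de (k : 'I_n) : degree e k = (f k + (f k <= (degree e u).-1))%N.
  rewrite fE /r /low; have [->|_] := eqVneq k u; have := d_gt0 u; have := d_gt0 k.
    by rewrite orbT; lia.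
  by rewrite orbF; case: ltnP; lia.
pose e' : rel 'I_n := fun i j => e (f^-1%g i) (f^-1%g j).
rewrite -(@graph_of_sorted_degrees n (degree e u).-1 e').
- by rewrite /e' !permK.
- by split=> [x y|x]; rewrite /e' ?eirr // esym.
- move=> k; rewrite -{2 3}(permKV f k) -de !degree_sum.
  by rewrite [RHS](reindex_inj (@perm_inj _ f^-1%g)).
Qed.

(** * The eigenvalue equation and the spectral gap *)

Lemma eigenvalue_perm (R : realType) (n : nat) (e e' : rel 'I_n)
    (f : {perm 'I_n}) (x : R) :
  (forall i j, e i j = e' (f i) (f j)) ->
  eigenvalue (adjacency_mx R e) x -> eigenvalue (adjacency_mx R e') x.
Proof.
move=> ee' /eigenvalueP[v vA v0]; apply/eigenvalueP.
exists (\row_i v 0 (f^-1%g i)); last first.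
  apply: contraNneq v0 => w0; apply/eqP/rowP => i.
  by have /rowP/(_ (f i)) := w0; rewrite !mxE permK.
apply/rowP => j; rewrite !mxE.
have /rowP/(_ (f^-1%g j)) := vA; rewrite !mxE => <-.
rewrite (reindex_inj (@perm_inj _ f)) /=; apply: eq_bigr => i _.
by rewrite !mxE permK ee' permKV.
Qed.

(** Here n is the last index. Row j says that (x + [n <= 2j]) X_j is the sum of the last j + 1
    entries, the indicator compensating for the missing loop; what is kept is row 0 and the
    differences of consecutive rows. *)
Lemma eigenvalue_thresholdP (R : realType) (n : nat) (x : R) : (0 < n)%N ->
  eigenvalue (adjacency_mx R (threshold n.+1)) x <->
  exists X : nat -> R,
    [/\ exists2 i, (i <= n)%N & X i != 0, x * X 0%N = X n &
        forall j, (j < n)%N ->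
          (x + (n <= j.*2.+2)%:R) * X j.+1 - (x + (n <= j.*2)%:R) * X j = X (n - j.+1)%N].
Proof.
move=> n0.
have rowE (v : 'rV[R]_n.+1) (X : nat -> R) (j : 'I_n.+1) :
    (forall i : 'I_n.+1, v 0 i = X i) ->
    (v *m adjacency_mx R (threshold n.+1)) 0 j =
    \sum_(n - j <= i < n.+1) X i - (n <= j.*2)%:R * X j.
  move=> vX; rewrite mxE (big_nat_widenl _ 0) // big_mkord [in RHS]big_mkcond /=.
  rewrite (bigD1 j) //= [X in _ = X - _](bigD1 j) //=.
  rewrite mxE /threshold eqxx mulr0 add0r [in RHS]addrAC.
  have -> : (if (n - j <= j)%N then X j else 0) - (n <= j.*2)%:R * X j = 0 :> R.
    have -> : (n - j <= j)%N = (n <= j.*2)%N by lia.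
    by case: ifP; rewrite ?mul1r ?mul0r subrr.
  rewrite add0r; apply: eq_bigr => i ij; rewrite mxE ij vX ltnS leq_subLR addnC /=.
  by case: ifP; rewrite ?mulr1 ?mulr0.
have sumS (X : nat -> R) j : (j < n)%N ->
    \sum_(n - j.+1 <= i < n.+1) X i = X (n - j.+1)%N + \sum_(n - j <= i < n.+1) X i.
  by move=> jn; rewrite big_ltn ?subnSK //; lia.
have sum0 (X : nat -> R) : \sum_(n - 0 <= i < n.+1) X i = X n.
  by rewrite subn0 big_nat1.
have n20 : (n <= 0)%N = false by lia.
split=> [/eigenvalueP[v vA v0]|[X [[i i_n Xi] X0 XS]]].
  pose X i := v 0 (inord i).
  have vX (i : 'I_n.+1) : v 0 i = X i by rewrite /X inord_val.
  have E j : (j <= n)%N ->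
      (x + (n <= j.*2)%:R) * X j = \sum_(n - j <= i < n.+1) X i.
    move=> jn; have /rowP/(_ (inord j)) := vA; rewrite (rowE _ X) // mxE vX inordK //.
    by move/eqP; rewrite subr_eq -mulrDl => /eqP.
  exists X; split.
  - have /rV0Pn[i vi] := v0; exists (val i); first by rewrite -ltnS /=.
    by rewrite -vX.
  - by have := E 0%N (leq0n n); rewrite double0 n20 addr0 sum0.
  - move=> j jn; have := E j.+1 jn; rewrite doubleS => ->.
    by rewrite (E j (ltnW jn)) sumS ?addrK.
have E j : (j <= n)%N ->
    (x + (n <= j.*2)%:R) * X j = \sum_(n - j <= i < n.+1) X i.
  elim: j => [_|j IH jn]; first by rewrite double0 n20 addr0 sum0.
  by rewrite sumS // -(IH (ltnW jn)) -XS // doubleS subrK.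
apply/eigenvalueP; exists (\row_i X i).
  apply/rowP => j; rewrite (rowE _ X) => [|k]; last by rewrite mxE.
  by rewrite -(E j (ltn_ord j)) !mxE mulrDl addrK.
by apply/rV0Pn; exists (Ordinal (i_n : (i < n.+1)%N)); rewrite mxE.
Qed.

(* Halves of an eigenvector of the threshold graph for the eigenvalue x, read
   from its two ends towards the middle: with s = x (x + 1), the entries of
   index t and (last - t) are a X_0 and x b X_0, where (a, b) = ends s t. *)
Fixpoint ends (R : realType) (s : R) (t : nat) : R * R :=
  if t is t'.+1 then
    let: (a, b) := ends R s t' in (a + (b - a / s), b - a / s)
  else (1, 1).

Lemma ends_neg (R : realType) (s : R) (t : nat) : s < 0 ->
  0 < (ends R s t).1 /\ 0 < (ends R s t).2.
Proof.
move=> s0; elim: t => [|t] /=; first by rewrite ltr01.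
case: (ends R s t) => a b /= [a0 b0].
have : 0 < a / - s by rewrite divr_gt0 // oppr_gt0.
by rewrite invrN mulrN => h; split; lra.
Qed.

(** Each step exchanges the cone a <= b < 2a with its opposite: since 1/s > 4, the new b lies below
    -2a, and the new a exceeds it by the old a. *)
Lemma ends_small (R : realType) (s : R) (t : nat) : 0 < s < 1 / 4 ->
  let: (a, b) := ends R s t in
  (0 < a /\ a <= b < 2 * a) \/ (a < 0 /\ 2 * a < b <= a).
Proof.
move=> /andP[s0 s4]; elim: t => [|t] /=; first by left; lra.
have ds : s * s^-1 = 1 by rewrite mulfV // gt_eqF.
have s4' : 4 < s^-1 by nra.
by case: (ends R s t) => a b [[a0 /andP[ab ba]]|[a0 /andP[ab ba]]];
  [right|left]; split; try (apply/andP; split); nra.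
Qed.

Lemma threshold_eigenvalue_gap (R : realType) (n : nat) (x : R) : (0 < n)%N ->
  eigenvalue (adjacency_mx R (threshold n.+1)) x -> x * (x + 1) != 0 ->
  1 / 4 <= x * (x + 1).
Proof.
move=> n0 /(eigenvalue_thresholdP R n x n0)[X [[i0 i0n Xi0] X0 XS]] s0.
set s := x * (x + 1) in s0 *; rewrite leNgt; apply/negP => s4.
have [x0 x1] : x != 0 /\ x + 1 != 0.
  by split; apply: contraNneq s0 => h; rewrite /s h ?mul0r ?mulr0.
have endsE t : (t.*2 < n)%N ->
    X t = (ends R s t).1 * X 0%N /\ X (n - t)%N = x * (ends R s t).2 * X 0%N.
  elim: t => [_|t IH tn]; first by rewrite subn0 -X0 /=; split; ring.
  have [Xt Xnt] : X t = (ends R s t).1 * X 0%N /\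
      X (n - t)%N = x * (ends R s t).2 * X 0%N by apply: IH; lia.
  have lo := XS t ltac:(lia).
  have hi := XS (n - t.+1)%N ltac:(lia).
  have e1 : (n <= t.*2.+2)%N = false by lia.
  have e2 : (n <= t.*2)%N = false by lia.
  have e3 : (n <= (n - t.+1).*2.+2)%N = true by lia.
  have e4 : (n <= (n - t.+1).*2)%N = true by lia.
  have e5 : (n - t.+1).+1 = (n - t)%N by lia.
  have e6 : (n - (n - t))%N = t by lia.
  rewrite e1 e2 /= in lo; rewrite e3 e4 e5 e6 /= in hi.
  move: Xt Xnt => /=; case: (ends R s t) => a b /= Xt Xnt.
  have hi' : X (n - t.+1)%N = X (n - t)%N - X t / (x + 1).
    by rewrite -hi; field.
  have lo' : X t.+1 = X t + X (n - t.+1)%N / x by rewrite -lo; field.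
  by rewrite lo' hi' Xt Xnt /s; split; field; rewrite x0 x1.
(* The halves meet in x b = a for n odd and in s b = (x + 2) a for n even. If s < 0 then -1 < x < 0
   and signs disagree. If 0 < s < 1/4 then 1 <= b/a < 2: the first needs x > 1/2 although x < 1/4,
   the second fails as s b/a < 1/2 < x + 2. *)
have mid a b : x * b = a \/ s * b = (x + 2) * a ->
    ~ ((s < 0 /\ 0 < a /\ 0 < b) \/
       (0 < s /\ ((0 < a /\ a <= b < 2 * a) \/ (a < 0 /\ 2 * a < b <= a)))).
  have sE : s = x * (x + 1) by [].
  move=> E [[sneg [a0 b0]]|[spos ab]].
    have [xlt xgt] : x < 0 /\ -1 < x by split; nra.
    by case: E => E; nra.
  have x2 : 1 / 2 < x + 2 by rewrite ltNge; apply/negP => ?; nra.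
  case: E => E; last first.
    by case: ab => [[a0 /andP[ab ba]]|[a0 /andP[ba ab]]]; nra.
  have xlt : x < 1 / 4 by rewrite ltNge; apply/negP => ?; nra.
  have xgt : 0 < x by case: ab => [[a0 /andP[ab ba]]|[a0 /andP[ba ab]]]; nra.
  by case: ab => [[a0 /andP[ab ba]]|[a0 /andP[ba ab]]]; nra.
have {}mid t : (t.*2 < n)%N ->
    x * (ends R s t).2 * X 0%N = (ends R s t).1 * X 0%N \/
    s * (ends R s t).2 * X 0%N = (x + 2) * (ends R s t).1 * X 0%N -> X 0%N = 0.
  move=> tn E; apply/eqP/negPn/negP => X00.
  apply: (mid (ends R s t).1 (ends R s t).2).
    by case: E => /(mulIf X00) E; [left|right].
  have [sneg|spos] := ltP s 0; first by left; split => //; apply: ends_neg.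
  have spos' : 0 < s by rewrite lt_neqAle eq_sym s0.
  right; split=> //; have := ends_small R s t; rewrite spos' s4 => /(_ isT).
  by case: (ends R s t).
have X00 : X 0%N = 0.
  have [k [nk|nk]] : exists k, n = k.*2.+1 \/ n = k.*2.+2.
    by exists (n.-1./2); lia.
  - apply: (mid k); first lia.
    have [Xk Xnk] := endsE k ltac:(lia).
    have := XS k ltac:(lia); rewrite nk in Xnk *.
    have -> : (k.*2.+1 <= k.*2.+2)%N = true by lia.
    have -> : (k.*2.+1 <= k.*2)%N = false by lia.
    have e : (k.*2.+1 - k)%N = k.+1 by lia.
    rewrite e in Xnk; rewrite subnS e /= => E.
    left; rewrite -Xnk -Xk; apply: (mulfI x1).
    by lra.
  - apply: (mid k); first lia.
    have [Xk Xnk] := endsE k ltac:(lia).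
    have E1 := XS k ltac:(lia); have E2 := XS k.+1 ltac:(lia).
    have e1 : (n <= k.*2.+2)%N = true by lia.
    have e2 : (n <= k.*2)%N = false by lia.
    have e3 : (n <= k.+1.*2.+2)%N = true by lia.
    have e4 : (n <= k.+1.*2)%N = true by lia.
    have e5 : (n - k.+1)%N = k.+1 by lia.
    have e6 : (n - k.+2)%N = k by lia.
    have e7 : (n - k)%N = k.+2 by lia.
    rewrite e1 e2 e5 /= in E1; rewrite e3 e4 e6 /= in E2; rewrite e7 in Xnk.
    have Xk1 : X k.+1 = X k by apply: (mulfI x0); lra.
    right; have -> : s * (ends R s k).2 * X 0%N = (x + 1) * X k.+2.
      by rewrite Xnk /s; ring.
    by rewrite -mulrA -Xk; move: E2; rewrite Xk1; lra.
have Xlow t : (t.*2 < n)%N -> X t = 0 /\ X (n - t)%N = 0.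
  by move=> /endsE[-> ->]; rewrite X00 !mulr0.
case/eqP: Xi0; have [i0lt|i0gt|i0n2] := ltngtP i0.*2 n.
- exact: (Xlow _ i0lt).1.
- have := (Xlow (n - i0)%N ltac:(lia)).2; by rewrite subKn.
(* For n even the middle entry belongs to neither half; its own equation reduces to x X = 0. *)
- case: i0 i0n i0n2 => [|k] kn kn2; first by [].
  have := XS k ltac:(lia); have -> : (n - k.+1)%N = k.+1 by lia.
  have -> : (n <= k.*2.+2)%N = true by lia.
  have -> : (n <= k.*2)%N = false by lia.
  have [-> _] := Xlow k ltac:(lia).
  rewrite mulr0 subr0 /= => E; apply: (mulfI x0); move: E; lra.
Qed.

Lemma antiregular_spectrumE (R : realType) (n : nat) (x : R) : (0 < n)%N ->
  antiregular_spectrum R n.+1 x <-> eigenvalue (adjacency_mx R (threshold n.+1)) x.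
Proof.
move=> n0; split=> [[e [es ec ea ex]]|ex].
  have [f fE] := antiregular_threshold n.+1 e n0 es ec ea.
  exact: eigenvalue_perm fE ex.
exists (threshold n.+1); split=> //; first exact: threshold_simple.
  exact: threshold_connected.
exact: threshold_antiregular.
Qed.

Lemma all_antiregular_eigenvaluesP (R : realType) (x : R) :
  all_antiregular_eigenvalues R x <->
  exists2 n, (0 < n)%N & eigenvalue (adjacency_mx R (threshold n.+1)) x.
Proof.
split=> [[[|n] //= n2 /(antiregular_spectrumE R n x n2) ex]|[n n0 ex]].
  by exists n.
by exists n.+1 => //; apply/antiregular_spectrumE.
Qed.

Lemma gap_complement (R : realType) (x : R) :
  1 / 4 <= x * (x + 1) <->
  x <= (- 1 - Num.sqrt 2) / 2 \/ (- 1 + Num.sqrt 2) / 2 <= x.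
Proof.
have r0 : 0 <= Num.sqrt 2 :> R by apply: sqrtr_ge0.
have r2 : Num.sqrt 2 * Num.sqrt 2 = 2 :> R by rewrite -expr2 sqr_sqrtr.
set r := Num.sqrt 2 in r0 r2 *.
have xE : x * (x + 1) - 1 / 4 = (x - (- 1 - r) / 2) * (x - (- 1 + r) / 2).
  by rewrite -[in LHS](mul1r 1); nra.
split=> [xs|[xl|xl]]; last 2 first.
- by rewrite -subr_ge0 xE; nra.
- by rewrite -subr_ge0 xE; nra.
have [?|xl] := leP x ((- 1 - r) / 2); [by left|right].
by rewrite leNgt; apply/negP => xr; nra.
Qed.

(** * Density of the eigenvalues *)

(** Read from the end, the upper half is C m = cos((2m+1) phi), with 1/s = 4 sin^2 phi in the
    recurrence. The upper rows dictate (x + 1)(C_i - C_(i+1)) for the lower half, and the last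
    hypothesis is the equation across the middle. *)
Lemma cosine_eigenvector (R : realType) (k : nat) (phi x : R) :
  cos phi != 0 -> 4 * sin phi ^+ 2 * (x * (x + 1)) = 1 ->
  (x + 1) * cos (k.*2.+3%:R * phi) = x * cos (k.*2.+1%:R * phi) ->
  eigenvalue (adjacency_mx R (threshold k.*2.+2)) x.
Proof.
move=> c0 sx mid; apply/eigenvalue_thresholdP => //.
pose C m := cos (m.*2.+1%:R * phi).
have C0 : C 0%N = cos phi by rewrite /C mul1r.
have C1 : C 0%N - C 1%N = 4 * sin phi ^+ 2 * C 0%N.
  rewrite /C; have -> : 1.*2.+1%:R * phi = phi + phi + phi :> R.
    by rewrite -[1.*2.+1%:R]/(3%:R : R); ring.
  have -> : 0.*2.+1%:R * phi = phi :> R by rewrite mul1r.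
  rewrite !(cosD, sinD); have := cos2Dsin2 phi; nra.
have CS m : 2 * C m.+1 - C m - C m.+2 = 4 * sin phi ^+ 2 * C m.+1.
  set y := m.+1.*2.+1%:R * phi.
  have -> : C m = cos (y - (phi + phi)).
    by rewrite /C /y; congr cos; rewrite doubleS -[m.*2.+3]addn2 natrD; ring.
  have -> : C m.+2 = cos (y + (phi + phi)).
    by rewrite /C /y; congr cos; rewrite !doubleS -[m.*2.+1.+4]addn2 natrD; ring.
  rewrite -/(C m.+1) {1 2}/C -/y cosB !cosD sinD.
  have -> : cos phi * cos phi = 1 - sin phi ^+ 2 by have := cos2Dsin2 phi; lra.
  ring.
exists (fun i => if (i <= k)%N then (x + 1) * (C i - C i.+1) else C (k.*2.+1 - i)%N).
have nk : (k.*2.+1 <= k)%N = false by lia.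
split.
- exists k.*2.+1 => //; by rewrite nk subnn C0.
- by rewrite nk subnn /= C1 mulrA mulrCA mulrA sx mul1r.
- move=> j jn; rewrite /=.
  have [jk|kj|jk] := ltngtP j k.
  + have -> : (k.*2.+1 <= j.*2.+2)%N = false by lia.
    have -> : (k.*2.+1 <= j.*2)%N = false by lia.
    have -> : (k.*2.+1 - j.+1 <= k)%N = false by lia.
    have -> : (k.*2.+1 - (k.*2.+1 - j.+1))%N = j.+1 by lia.
    rewrite !addr0 -[RHS](_ : (2 * C j.+1 - C j - C j.+2) * (x * (x + 1)) = _).
      by ring.
    by rewrite CS mulrAC sx mul1r.
  + have -> : (k.*2.+1 <= j.*2.+2)%N by lia.
    have -> : (k.*2.+1 <= j.*2)%N by lia.
    have -> : (k.*2.+1 - j.+1 <= k)%N by lia.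
    have -> : (k.*2.+1 - j)%N = (k.*2.+1 - j.+1).+1 by lia.
    rewrite /=; ring.
  + rewrite jk.
    have -> : (k.*2.+1 <= k.*2.+2)%N by lia.
    have -> : (k.*2.+1 <= k.*2)%N = false by lia.
    have -> : (k.*2.+1 - k.+1)%N = k by lia.
    have {}mid : (x + 1) * C k.+1 = x * C k by rewrite /C doubleS.
    have -> : (x + 1) * (C k - C k.+1) = C k by rewrite mulrBr mid; ring.
    by rewrite leqnn /=; ring.
Qed.

(* The positive ([b = false]) or negative ([b = true]) solution x of
   4 sin^2 phi x (x + 1) = 1. *)
Definition branch (R : realType) (b : bool) (phi : R) : R :=
  (- 1 + (-1) ^+ b * Num.sqrt (1 + (sin phi ^+ 2)^-1)) / 2.

Lemma branch_eq (R : realType) (b : bool) (phi : R) : sin phi != 0 ->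
  4 * sin phi ^+ 2 * (branch R b phi * (branch R b phi + 1)) = 1.
Proof.
move=> s0; rewrite /branch.
have r0 : 0 <= 1 + (sin phi ^+ 2)^-1 by rewrite addr_ge0 // invr_ge0 sqr_ge0.
have rr : Num.sqrt (1 + (sin phi ^+ 2)^-1) * Num.sqrt (1 + (sin phi ^+ 2)^-1) =
          1 + (sin phi ^+ 2)^-1 by rewrite -expr2 sqr_sqrtr.
set r := Num.sqrt _ in rr *.
have bb : (-1) ^+ b * (-1) ^+ b = 1 :> R by case: b; rewrite /=; ring.
set e := (-1) ^+ b in bb *.
have -> : 4 * sin phi ^+ 2 * ((- 1 + e * r) / 2 * ((- 1 + e * r) / 2 + 1)) =
          sin phi ^+ 2 * ((e * e) * (r * r) - 1) by field.
by rewrite bb rr; field.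
Qed.

Lemma branch_sign (R : realType) (b : bool) (phi : R) : sin phi != 0 ->
  0 < (-1) ^+ b * branch R b phi.
Proof.
move=> s0.
have i0 : 0 < (sin phi ^+ 2)^-1 by rewrite invr_gt0 exprn_even_gt0.
have r1 : 1 < Num.sqrt (1 + (sin phi ^+ 2)^-1).
  by rewrite -[X in X < _]sqrtr1 ltr_sqrt; lra.
by rewrite /branch; case: b; rewrite /= ?expr0 ?expr1; lra.
Qed.

Lemma branch_continuous (R : realType) (b : bool) (phi : R) : sin phi != 0 ->
  {for phi, continuous (branch R b)}.
Proof.
move=> s0.
have sin2 : {for phi, continuous (fun y : R => sin y ^+ 2)}.
  by apply: continuousM; exact: continuous_sin.
have inv2 : {for phi, continuous (fun y : R => (sin y ^+ 2)^-1)}.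
  by apply: continuousV => //; rewrite expf_neq0.
apply: cvgM; last exact: cvg_cst.
apply: cvgD; first exact: cvg_cst.
apply: cvgM; first exact: cvg_cst.
apply: continuous_comp; last exact: sqrt_continuous.
apply: cvgD; first exact: cvg_cst.
exact: inv2.
Qed.

(** The angle is phi = asin(1 / sqrt(4s)), which exists because 4s >= 1; the sign of x selects the
    branch. *)
Lemma branch_surj (R : realType) (x : R) : 1 / 4 <= x * (x + 1) ->
  exists b, exists2 phi, 0 < phi <= pi / 2 & branch R b phi = x.
Proof.
move=> xs; set s := x * (x + 1) in xs.
have s0 : 0 < 4 * s by lra.
have t1 : 1 <= Num.sqrt (4 * s) by rewrite -[X in X <= _]sqrtr1 ler_sqrt; lra.
have t0 : 0 < Num.sqrt (4 * s) by lra.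
have it0 : 0 < (Num.sqrt (4 * s))^-1 by rewrite invr_gt0.
have it1 : (Num.sqrt (4 * s))^-1 <= 1 by rewrite invf_le1.
have /asin_def[/andP[p1 p2] sp] : -1 <= (Num.sqrt (4 * s))^-1 <= 1.
  by apply/andP; split=> //; lra.
set phi := asin _ in p1 p2 sp.
exists (x < 0), phi.
  rewrite p2 andbT ltNge; apply/negP => p0.
  have pi0 : 0 < pi :> R by apply: pi_gt0.
  have : 0 <= sin (- phi) by apply: sin_ge0_pi; apply/andP; split; lra.
  by rewrite sinN sp; lra.
rewrite /branch sp exprVn invrK sqr_sqrtr; last lra.
have -> : 1 + 4 * s = (2 * x + 1) ^+ 2 by rewrite /s; ring.
rewrite sqrtr_sqr.
have [x0|x0] := ltP x 0; rewrite /= ?expr0 ?expr1.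
  have : x < -1 by rewrite /s in xs; nra.
  by move=> x1; rewrite ltr0_norm; lra.
by rewrite ger0_norm; lra.
Qed.

(** At a node (2k+3) t = i pi + pi/2 the difference [f] equals -(-1)^i x sin(2t). As x keeps its
    sign on a branch and sin(2t) > 0, [f] changes sign between consecutive nodes, and its zero
    satisfies the middle equation of [cosine_eigenvector]. *)
Lemma branch_nodes (R : realType) (b : bool) (phi psi : R) (k m : nat) :
  0 < phi -> phi < psi -> psi < pi / 2 ->
  k.*2.+3%:R * phi = m%:R * pi + pi / 2 ->
  k.*2.+3%:R * psi = m.+1%:R * pi + pi / 2 ->
  exists2 t, phi <= t <= psi &
    eigenvalue (adjacency_mx R (threshold k.*2.+2)) (branch R b t).
Proof.
move=> phi0 phipsi psi2 phiE psiE.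
have pi0 : 0 < pi :> R by apply: pi_gt0.
have s0 t : phi <= t <= psi -> sin t != 0.
  by move=> /andP[t1 t2]; rewrite gt_eqF // sin_gt0_pihalf //; apply/andP; split; lra.
pose f t := (branch R b t + 1) * cos (k.*2.+3%:R * t) -
            branch R b t * cos (k.*2.+1%:R * t).
have cosm (i : nat) : cos (i%:R * pi + pi / 2) = 0 :> R.
  rewrite cosDpihalf; apply/eqP; rewrite oppr_eq0; apply/eqP.
  by elim: i => [|i IH]; rewrite ?mul0r ?sin0 // mulrSr mulrDl mul1r sinDpi IH oppr0.
have sinm (i : nat) : sin (i%:R * pi + pi / 2) = (-1) ^+ i :> R.
  rewrite sinDpihalf; elim: i => [|i IH]; first by rewrite mul0r cos0 expr0.
  by rewrite mulrSr mulrDl mul1r cosDpi IH exprS mulN1r.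
have fnode (t : R) (i : nat) : k.*2.+3%:R * t = i%:R * pi + pi / 2 ->
    f t = - ((-1) ^+ i * branch R b t * sin (t + t)).
  move=> tE; rewrite /f.
  have -> : k.*2.+1%:R * t = k.*2.+3%:R * t - (t + t).
    by rewrite -[k.*2.+3]addn2 natrD; ring.
  by rewrite cosB tE cosm sinm; ring.
have node_sign (t : R) : phi <= t <= psi ->
    0 < (-1) ^+ b * branch R b t * sin (t + t).
  move=> tI; rewrite mulr_gt0 ?branch_sign ?s0 // sin_gt0_pi //.
  by case/andP: tI => t1 t2; apply/andP; split; lra.
have fcont : {within `[phi, psi], continuous f}.
  apply: continuous_in_subspaceT => t /set_mem; rewrite /= in_itv /= => tI.
  have bt := branch_continuous R b t (s0 t tI).
  have ct (c : R) : {for t, continuous (fun t => cos (c * t))}.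
    by apply: continuous_comp; [exact: mulrl_continuous|exact: continuous_cos].
  apply: cvgB; apply: cvgM => //; [|exact: ct|exact: ct].
  by apply: cvgD => //; exact: cvg_cst.
have nphi := node_sign phi ltac:(lra).
have npsi := node_sign psi ltac:(lra).
have fphi := fnode _ _ phiE; have fpsi := fnode _ _ psiE.
have [|t] := IVT (v := 0) (ltW phipsi) fcont.
  have sgn (i : nat) : (-1) ^+ i = 1 :> R \/ (-1) ^+ i = -1 :> R.
    by rewrite -signr_odd; case: (odd i); [right|left].
  rewrite fphi fpsi exprS ge_min le_max; move: nphi npsi.
  case: (sgn b) => ->; case: (sgn m) => -> ? ?;
    by apply/andP; split; apply/orP; first [left; lra | right; lra].
rewrite in_itv /= => tI ft; exists t => //.
apply: (cosine_eigenvector R k t).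
- rewrite gt_eqF // cos_gt0_pihalf //; case/andP: tI => t1 t2.
  by apply/andP; split; lra.
- by apply: branch_eq; apply: s0.
- by move/eqP: ft; rewrite subr_eq0 => /eqP.
Qed.

Lemma nodes_dense (R : realType) (a c : R) : 0 <= a -> a < c ->
  exists k m : nat,
    a < (m%:R * pi + pi / 2) / k.*2.+3%:R /\
    (m.+1%:R * pi + pi / 2) / k.*2.+3%:R < c.
Proof.
move=> a0 ac; have pi0 : 0 < pi :> R by apply: pi_gt0.
(* Nodes are pi/(2k+3) apart, and this k makes the interval longer than three gaps. With m the
   integer part of (2k+3) a / pi, nodes m + 1 and m + 2 lie beyond a by at most 5/2 gaps. *)
pose k := Num.truncn (3 * pi / (c - a)).
have k0 : 0 < k.*2.+3%:R :> R by rewrite ltr0n.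
have kP : 3 * pi < k.*2.+3%:R * (c - a).
  rewrite -ltr_pdivrMr ?subr_gt0 //.
  by apply: lt_trans (truncnS_gt _) _; rewrite ltr_nat -/k; lia.
have y0 : 0 <= k.*2.+3%:R * a / pi by exact: divr_ge0 (mulr_ge0 (ltW k0) a0) (ltW pi0).
have /andP[] := truncn_itv y0.
set m := Num.truncn _; rewrite ler_pdivlMr // ltr_pdivrMr // => m1 m2.
exists k, m.+1; rewrite ltr_pdivlMr // ltr_pdivrMr //.
rewrite ![m.+2%:R]mulrSr ![m.+1%:R]mulrSr in m2 *.
set K : R := k.*2.+3%:R in kP m1 m2 *; split; nra.
Qed.

Lemma large_eigenvalues_dense (R : realType) (x : R) : 1 / 4 <= x * (x + 1) ->
  closure (all_antiregular_eigenvalues R) x.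
Proof.
move=> /branch_surj[b [p0 /andP[p0_gt0 p0_le] <-]] U.
have pi0 : 0 < pi :> R by apply: pi_gt0.
have sp0 : sin p0 != 0.
  by rewrite gt_eqF // sin_gt0_pi //; apply/andP; split; lra.
move=> /(branch_continuous R b p0 sp0)/nbhs_ballP[d /= d0 dU].
(* Nodes are sought to the left of [p0], which may be pi/2, where the strict upper bound of
   [branch_nodes] would fail. *)
have am : Num.max 0 (p0 - d) < p0 by rewrite gt_max p0_gt0 ltrBlDr ltrDl.
have a0 : 0 <= Num.max 0 (p0 - d) by rewrite le_max lexx.
have ad : p0 - d <= Num.max 0 (p0 - d) by rewrite le_max lexx orbT.
have [k [m [h1 h2]]] := nodes_dense R _ _ a0 am.
set a := Num.max 0 (p0 - d) in am a0 ad h1.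
have k0 : 0 < k.*2.+3%:R :> R by rewrite ltr0n.
set phi := _ / _ in h1; set psi := _ / _ in h2.
have phipsi : phi < psi.
  by rewrite ltr_pM2r ?invr_gt0 // ltrD2r ltr_pM2r // ltr_nat.
have [||||t /andP[t1 t2] et] := branch_nodes R b phi psi k m _ phipsi.
- by lra.
- by lra.
- by rewrite mulrC divfK // gt_eqF.
- by rewrite mulrC divfK // gt_eqF.
exists (branch R b t); split.
  by apply/all_antiregular_eigenvaluesP; exists k.*2.+1.
by apply: dU; rewrite /ball /= gtr0_norm; lra.
Qed.

(** * The isolated points 0 and -1, and the closure *)

Lemma zero_eigenvalue (R : realType) : all_antiregular_eigenvalues R 0.
Proof.
apply/all_antiregular_eigenvaluesP; exists 2%N => //.
apply/eigenvalue_thresholdP => //.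
(* A_3 is a path with centre 2; opposite entries at its two ends cancel at the centre. *)
exists (fun i => if i is 0 then 1 else if i is 1 then - 1 else 0); split.
- by exists 0%N => //; rewrite oner_neq0.
- by rewrite mul0r.
- by case=> [|[|//]] _ /=; ring.
Qed.

Lemma minus_one_eigenvalue (R : realType) : all_antiregular_eigenvalues R (- 1).
Proof.
apply/all_antiregular_eigenvaluesP; exists 1%N => //.
apply/eigenvalue_thresholdP => //.
exists (fun i => if i is 0 then 1 else - 1); split.
- by exists 0%N => //; rewrite oner_neq0.
- by rewrite mulr1.
- by case=> // _ /=; ring.
Qed.

Theorem theorem2p6 (R : realType) :
  closure (all_antiregular_eigenvalues R) =
  `]-oo, (- 1 - Num.sqrt 2) / 2] `|` [set 0; - 1]
    `|` `[(- 1 + Num.sqrt 2) / 2, +oo[.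
Proof.
have rhsE (x : R) : (`]-oo, (- 1 - Num.sqrt 2) / 2] `|` [set 0; - 1]
      `|` `[(- 1 + Num.sqrt 2) / 2, +oo[) x <->
    x = 0 \/ x = - 1 \/ 1 / 4 <= x * (x + 1).
  rewrite gap_complement /setU /= !in_itv /= andbT; tauto.
apply/seteqP; split.
  (* The right-hand side is closed, so it suffices that it contains each eigenvalue: s = 0 gives the
     isolated points, and the gap covers the rest. *)
  rewrite [X in _ `<=` X](iffLR (closure_id _)).
    apply: closure_subset => x /all_antiregular_eigenvaluesP[n n0 ex].
    apply/rhsE; have [/eqP|s0] := eqVneq (x * (x + 1)) 0.
      by rewrite mulf_eq0 addr_eq0 => /orP[/eqP|/eqP]; [left|right; left].
    by right; right; apply: threshold_eigenvalue_gap n0 ex s0.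
  apply: closedU; last exact: rray_closed.
  apply: closedU; first exact: lray_closed.
  by apply: closedU; exact: closed_eq.
move=> x /rhsE[->|[->|]].
- by apply: subset_closure; exact: zero_eigenvalue.
- by apply: subset_closure; exact: minus_one_eigenvalue.
- exact: large_eigenvalues_dense.
Qed.
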